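(* There exist a signature $\Sigma$ and a $\Sigma$-theory $\mathcal{T}$ such that some $\mathcal{T}$-language is not $\mathcal{T}$-regular.
   Context: Signatures are multi-sorted first-order signatures in which every symbol is marked either rigid or non-rigid. For a signature $\Sigma$, $\Sigma'$ denotes the signature obtained from $\Sigma$ by replacing each non-rigid symbol $s$ by a fresh primed copy $s'$ (rigid symbols are kept); for a $\Sigma$-structure $\sigma$, $\sigma'$ denotes the corresponding renamed $\Sigma'$-structure. For structures over pairwise disjoint signatures with the same sort domains, $\rho\cup\sigma\cup\tau'$ denotes the combined structure over the union of the signatures. A $\Sigma$-theory $\mathcal{T}$ is a set of $\Sigma$-sentences; $[\![\mathcal{T}]\!]$ is the set of all $\Sigma$-structures with finite or countably infinite domains that satisfy $\mathcal{T}$. A $\mathcal{T}$-word is a finite sequence $\bar\sigma=\langle\sigma_0,\ldots,\sigma_{n-1}\rangle$ ($n\ge 0$) of elements of $[\![\mathcal{T}]\!]$ such that for every sort $S$ and every rigid symbol $s$ of $\Sigma$, $S^{\sigma_i}=S^{\sigma_j}$ and $s^{\sigma_i}=s^{\sigma_j}$ for all $i,j$. $[\![\mathcal{T}]\!]^*$ is the set of all $\mathcal{T}$-words; a $\mathcal{T}$-language is a subset of $[\![\mathcal{T}]\!]^*$. A first-order automaton is a tuple $\mathcal{A}=\langle\Sigma,\Gamma,\phi_0,\phi_T,\phi_F\rangle$ where $\Sigma$ (word signature) and $\Gamma$ (state signature) are finite disjoint signatures, $\phi_0$ and $\phi_F$ are first-order $\Gamma$-sentences, and $\phi_T$ is a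 first-order $(\Gamma\cup\Sigma\cup\Gamma')$-sentence. Given a $\mathcal{T}$-word $\bar\sigma=\langle\sigma_0,\ldots,\sigma_{n-1}\rangle$, a $\mathcal{T}$-run of $\mathcal{A}$ induced by $\bar\sigma$ is a sequence $\langle\rho_0,\ldots,\rho_n\rangle$ of $\Gamma$-structures such that $S^{\rho_i}=S^{\sigma_0}$ for every sort $S$ and every $i$, rigid symbols of $\Gamma$ are interpreted identically in all $\rho_i$, $\rho_0\models\phi_0$, and $\rho_i\cup\sigma_i\cup\rho'_{i+1}\models\phi_T$ for all $0\le i<n$. $\mathcal{A}$ $\mathcal{T}$-accepts $\bar\sigma$ iff some such run satisfies $\rho_n\models\phi_F$. $\mathcal{L}_{\mathcal{T}}(\mathcal{A})$ is the set of $\mathcal{T}$-words $\mathcal{T}$-accepted by $\mathcal{A}$. A $\mathcal{T}$-language $L$ is $\mathcal{T}$-regular iff $L=\mathcal{L}_{\mathcal{T}}(\mathcal{A})$ for some first-order automaton $\mathcal{A}$ with word signature $\Sigma$. *)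

(* Defs.v *)
From mathcomp Require Import all_boot.
From mathcomp Require Import boolp classical_sets functions cardinality.

Set Implicit Arguments.
Unset Strict Implicit.
Unset Printing Implicit Defensive.

Local Open Scope classical_set_scope.

(* Constants are function symbols of empty domain.  The sorts are a parameter
   because the signatures that are combined below share them. *)
Record signature (S : Type) : Type := Signature {
  fsym : Type;
  fdom : fsym -> seq S;
  fcod : fsym -> S;
  frigid : fsym -> bool;
  psym : Type;
  pdom : psym -> seq S;
  prigid : psym -> bool
}.

Definition finite_signature (S : Type) (Sg : signature S) : Prop :=
  [/\ finite_set [set: S], finite_set [set: fsym Sg] &
      finite_set [set: psym Sg]].

(* Symbols are elements of types, so the union of two disjoint signatures is
   the signature on the sum types. *)
Definition sig_union (S : Type) (Sg1 Sg2 : signature S) : signature S :=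
  {| fsym := (fsym Sg1 + fsym Sg2)%type;
     fdom := fun f => match f with inl g => fdom g | inr g => fdom g end;
     fcod := fun f => match f with inl g => fcod g | inr g => fcod g end;
     frigid := fun f => match f with inl g => frigid g | inr g => frigid g end;
     psym := (psym Sg1 + psym Sg2)%type;
     pdom := fun p => match p with inl q => pdom q | inr q => pdom q end;
     prigid := fun p =>
       match p with inl q => prigid q | inr q => prigid q end |}.

(* The primed copies of the non-rigid symbols of G.  The rigid symbols of the
   primed signature G' are those of G itself, so that this is the part that G'
   adds to a union that already contains G. *)
Definition sig_prime (S : Type) (G : signature S) : signature S :=
  {| fsym := {f : fsym G | ~~ frigid f};
     fdom := fun f => fdom (sval f);
     fcod := fun f => fcod (sval f);
     frigid := fun _ => false;
     psym := {p : psym G | ~~ prigid p};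
     pdom := fun p => pdom (sval p);
     prigid := fun _ => false |}.

(* G \cup Sg \cup G' *)
Definition sig_trans (S : Type) (G Sg : signature S) : signature S :=
  sig_union (sig_union G Sg) (sig_prime G).

(* Well-sorted de Bruijn syntax: [term Sg c s] and [form Sg c] are the terms of
   sort s and the formulas with free variables in the context c. *)
Inductive var (S : Type) : seq S -> S -> Type :=
| VZ (c : seq S) (s : S) : var (s :: c) s
| VS (c : seq S) (s s' : S) : var c s -> var (s' :: c) s.

Inductive term (S : Type) (Sg : signature S) (c : seq S) : S -> Type :=
| Var (s : S) : var c s -> term Sg c s
| App (f : fsym Sg) :
    (forall i : 'I_(size (fdom f)), term Sg c (tnth (in_tuple (fdom f)) i)) ->
    term Sg c (fcod f).

Inductive form (S : Type) (Sg : signature S) : seq S -> Type :=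
| FBot (c : seq S) : form Sg c
| FEq (c : seq S) (s : S) : term Sg c s -> term Sg c s -> form Sg c
| FRel (c : seq S) (p : psym Sg) :
    (forall i : 'I_(size (pdom p)), term Sg c (tnth (in_tuple (pdom p)) i)) ->
    form Sg c
| FNot (c : seq S) : form Sg c -> form Sg c
| FAnd (c : seq S) : form Sg c -> form Sg c -> form Sg c
| FOr (c : seq S) : form Sg c -> form Sg c -> form Sg c
| FImp (c : seq S) : form Sg c -> form Sg c -> form Sg c
| FAll (c : seq S) (s : S) : form Sg (s :: c) -> form Sg c
| FEx (c : seq S) (s : S) : form Sg (s :: c) -> form Sg c.

Definition sentence (S : Type) (Sg : signature S) : Type := form Sg [::].

Definition theory (S : Type) (Sg : signature S) : Type := set (sentence Sg).

Record domains (S : Type) : Type := Domains {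
  carrier :> S -> Type;
  carrier_inhabited : forall s : S, inhabited (carrier s)
}.

Definition args (S : Type) (D : domains S) (ss : seq S) : Type :=
  forall i : 'I_(size ss), D (tnth (in_tuple ss) i).

Record interp (S : Type) (Sg : signature S) (D : domains S) : Type := Interp {
  fint : forall f : fsym Sg, args D (fdom f) -> D (fcod f);
  pint : forall p : psym Sg, set (args D (pdom p))
}.

Arguments fint {S Sg D} i f _.
Arguments pint {S Sg D} i p _.

Record structure (S : Type) (Sg : signature S) : Type := Structure {
  sdom : domains S;
  sint : interp Sg sdom
}.
Arguments Structure {S Sg} sdom sint.

Definition env (S : Type) (D : domains S) (c : seq S) : Type :=
  forall s : S, var c s -> D s.

Definition env_nil (S : Type) (D : domains S) : env D [::] :=
  fun s (x : var [::] s) =>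
    match x in var c s0 return (if c is [::] then D s0 else unit) with
    | VZ _ _ => tt
    | VS _ _ _ _ => tt
    end.

Definition env_cons (S : Type) (D : domains S) (c : seq S) (s : S) (d : D s)
    (e : env D c) : env D (s :: c) :=
  fun s1 (x : var (s :: c) s1) =>
    match x in var c0 s0
      return (if c0 is s' :: c' then D s' -> env D c' -> D s0 else unit) with
    | VZ _ _ => fun d _ => d
    | VS _ _ _ y => fun _ e => e _ y
    end d e.

Fixpoint teval (S : Type) (Sg : signature S) (D : domains S)
    (I : interp Sg D) (c : seq S) (e : env D c) (s : S) (t : term Sg c s)
    : D s :=
  match t with
  | Var _ x => e _ x
  | App f ts => fint I f (fun i => teval I e (ts i))
  end.

Fixpoint holds (S : Type) (Sg : signature S) (D : domains S)
    (I : interp Sg D) (c : seq S) (phi : form Sg c) : env D c -> Prop :=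
  match phi with
  | FBot _ => fun e => False
  | FEq _ _ t u => fun e => teval I e t = teval I e u
  | FRel _ p ts => fun e => pint I p (fun i => teval I e (ts i))
  | FNot _ a => fun e => ~ holds I a e
  | FAnd _ a b => fun e => holds I a e /\ holds I b e
  | FOr _ a b => fun e => holds I a e \/ holds I b e
  | FImp _ a b => fun e => holds I a e -> holds I b e
  | FAll _ s a => fun e => forall d : D s, holds I a (env_cons d e)
  | FEx _ s a => fun e => exists d : D s, holds I a (env_cons d e)
  end.

Definition sat (S : Type) (Sg : signature S) (D : domains S)
    (I : interp Sg D) (phi : sentence Sg) : Prop :=
  holds I phi (@env_nil S D).

Definition interp_union (S : Type) (Sg1 Sg2 : signature S) (D : domains S)
    (I1 : interp Sg1 D) (I2 : interp Sg2 D) : interp (sig_union Sg1 Sg2) D :=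
  @Interp S (sig_union Sg1 Sg2) D
    (fun f => match f with inl g => fint I1 g
                         | inr g => fint I2 g end)
    (fun p => match p with inl q => pint I1 q | inr q => pint I2 q end).

Definition interp_prime (S : Type) (G : signature S) (D : domains S)
    (I : interp G D) : interp (sig_prime G) D :=
  @Interp S (sig_prime G) D
    (fun f => fint I (sval f)) (fun p => pint I (sval p)).

(* rho \cup sigma \cup tau' *)
Definition interp_trans (S : Type) (G Sg : signature S) (D : domains S)
    (rho : interp G D) (sigma : interp Sg D) (tau : interp G D)
    : interp (sig_trans G Sg) D :=
  interp_union (interp_union rho sigma) (interp_prime tau).

Definition same_rigid (S : Type) (Sg : signature S) (D : domains S)
    (I J : interp Sg D) : Prop :=
  (forall f : fsym Sg, frigid f -> fint I f = fint J f) /\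
  (forall p : psym Sg, prigid p -> pint I p = pint J p).

(* [countable] means finite or countably infinite. *)
Definition models (S : Type) (Sg : signature S) (T : theory Sg)
    : set (structure Sg) :=
  [set sigma | (forall s : S, countable [set: sdom sigma s]) /\
               forall phi : sentence Sg, T phi -> sat (sint sigma) phi].

(* A word is a plain sequence of structures, so that there is only one empty
   word; the letters of a word have the same sort domains when they all come
   from interpretations over one family D. *)
Definition words (S : Type) (Sg : signature S) (T : theory Sg)
    : set (seq (structure Sg)) :=
  [set w | exists (D : domains S) (n : nat) (l : n.-tuple (interp Sg D)),
     [/\ w = map (Structure D) l,
         forall i : 'I_n, models T (Structure D (tnth l i)) &
         forall i j : 'I_n, same_rigid (tnth l i) (tnth l j)]].

Definition is_language (S : Type) (Sg : signature S) (T : theory Sg)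
    (L : set (seq (structure Sg))) : Prop :=
  L `<=` words T.

Record automaton (S : Type) (Sg : signature S) : Type := Automaton {
  state_sig : signature S;
  word_sig_finite : finite_signature Sg;
  state_sig_finite : finite_signature state_sig;
  phi_0 : sentence state_sig;
  phi_T : sentence (sig_trans state_sig Sg);
  phi_F : sentence state_sig
}.

Definition is_run (S : Type) (Sg : signature S) (A : automaton Sg)
    (D : domains S) (n : nat) (l : n.-tuple (interp Sg D))
    (rho : n.+1.-tuple (interp (state_sig A) D)) : Prop :=
  [/\ forall i j : 'I_n.+1, same_rigid (tnth rho i) (tnth rho j),
      sat (tnth rho ord0) (phi_0 A) &
      forall i : 'I_n,
        sat (interp_trans (tnth rho (widen_ord (leqnSn n) i)) (tnth l i)
                          (tnth rho (lift ord0 i)))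
            (phi_T A)].

(* The equation on w determines D unless w is empty, in which case the domains
   of the run are unconstrained. *)
Definition accepts (S : Type) (Sg : signature S) (A : automaton Sg)
    (w : seq (structure Sg)) : Prop :=
  exists (D : domains S) (n : nat) (l : n.-tuple (interp Sg D))
         (rho : n.+1.-tuple (interp (state_sig A) D)),
    [/\ w = map (Structure D) l, is_run l rho &
        sat (tnth rho ord_max) (phi_F A)].

Definition lang (S : Type) (Sg : signature S) (T : theory Sg)
    (A : automaton Sg) : set (seq (structure Sg)) :=
  [set w | words T w /\ accepts A w].

Definition regular (S : Type) (Sg : signature S) (T : theory Sg)
    (L : set (seq (structure Sg))) : Prop :=
  exists A : automaton Sg, L = lang T A.

(* Main.v *)
Require Import Defs.
From mathcomp Require Import all_boot.
From mathcomp Require Import boolp classical_sets functions cardinality.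

(** Take one sort, one nullary non-rigid predicate, and the theory
    [forall x y, x = y]: a letter is then essentially a truth value.  Over a
    one-element domain a state structure over a finite signature is determined
    by the truth values of its predicates, so an automaton has finitely many
    states there, and the Myhill-Nerode argument shows that the language of
    the words [1^n 0^n] is not regular. *)

Set Implicit Arguments.
Unset Strict Implicit.
Unset Printing Implicit Defensive.

Local Open Scope classical_set_scope.

Section Runs.
Variables (S : Type) (Sg : signature S).

(** Equal structures have interpretations that agree only up to transport along a proof of [D = D];
    proof irrelevance turns that proof into [erefl]. *)
Lemma Structure_inj (D : domains S) : injective (@Structure S Sg D).
Proof.
move=> I J e.
have cast s : Structure D I = s ->
    exists h : D = sdom s, eq_rect D (interp Sg) I _ h = sint s.
  by case: _ /; exists erefl.
by have [h /= <-] := cast _ e; rewrite (Prop_irrelevance h erefl).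
Qed.

Lemma same_rigid_sym (G : signature S) (D : domains S) (I J : interp G D) :
  same_rigid I J -> same_rigid J I.
Proof. by case=> hf hp; split=> x xr; [rewrite hf | rewrite hp]. Qed.

Lemma same_rigid_trans (G : signature S) (D : domains S)
    (J I K : interp G D) :
  same_rigid I J -> same_rigid J K -> same_rigid I K.
Proof.
by case=> hf hp [kf kp]; split=> x xr; [rewrite hf ?kf | rewrite hp ?kp].
Qed.

(** States are indexed by [nat] rather than by a tuple, so that runs can be cut and glued without
    casts. *)
Definition accepting_run (A : automaton Sg) (D : domains S)
    (l : seq (interp Sg D)) (r : nat -> interp (state_sig A) D) : Prop :=
  [/\ forall i, i <= size l -> same_rigid (r 0) (r i), sat (r 0) (phi_0 A),
      forall x0 i, i < size l ->
        sat (interp_trans (r i) (nth x0 l i) (r i.+1)) (phi_T A) &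
      sat (r (size l)) (phi_F A)].

Lemma accepts_accepting_run (A : automaton Sg) (D : domains S)
    (l : seq (interp Sg D)) :
  0 < size l -> accepts A (map (Structure D) l) ->
  exists r, accepting_run (A := A) l r.
Proof.
move=> l_gt0 [D' [n [l' [rho [el [hr h0 hT] hF]]]]].
(* The first letter pins down the domains; this is where nonemptiness of [l] enters. *)
have eD : D' = D.
  case: l l_gt0 el => // x l _; case: l' hT => -[|y l'] //= _ _.
  by case.
move: n l' rho el hr h0 hT hF; rewrite {}eD {D'} => n l' rho el hr h0 hT hF.
have {el} el : l = l' :> seq _ by apply: (inj_map (@Structure_inj D)).
have sl : size l = n by rewrite el size_tuple.
exists (fun k => tnth rho (inord k)); split=> [i _||x0 i|] //.
- by rewrite (_ : inord 0 = ord0) //; apply: val_inj; rewrite /= inordK.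
- rewrite sl => lt_in; have := hT (Ordinal lt_in).
  rewrite (tnth_nth x0) -el /=.
  rewrite (_ : widen_ord _ _ = inord i); last first.
    by apply: val_inj; rewrite /= inordK // ltnS ltnW.
  rewrite (_ : lift _ _ = inord i.+1) //.
  by apply: val_inj; rewrite /= inordK.
- rewrite sl (_ : inord n = ord_max) //.
  by apply: val_inj; rewrite /= inordK.
Qed.

Lemma accepting_run_accepts (A : automaton Sg) (D : domains S)
    (l : seq (interp Sg D)) r :
  accepting_run (A := A) l r -> accepts A (map (Structure D) l).
Proof.
case=> hr h0 hT hF.
exists D, (size l), (in_tuple l), [tuple r i | i < (size l).+1].
split=> //; last by rewrite tnth_mktuple.
split=> [i j||i]; rewrite ?tnth_mktuple //.
  apply: (same_rigid_trans (J := r 0)); last by apply: hr; rewrite -ltnS.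
  by apply/same_rigid_sym/hr; rewrite -ltnS.
(* Letter [i] itself serves as the default value of [nth]. *)
by rewrite (tnth_nth (tnth (in_tuple l) i)) /=; apply: hT.
Qed.

(** The exchange step of Myhill-Nerode: what may follow depends only on the current state, so the
    second run can take over from the first where the two meet. *)
Lemma accepting_run_cat (A : automaton Sg) (D : domains S)
    (u v u' v' : seq (interp Sg D)) r r' :
  accepting_run (A := A) (u ++ v) r -> accepting_run (A := A) (u' ++ v') r' ->
  r (size u) = r' (size u') -> accepts A (map (Structure D) (u ++ v')).
Proof.
move=> [hr h0 hT _] [hr' _ hT' hF'] e.
pose q k := if k <= size u then r k else r' (k - size u + size u').
(* The case [k = 0] is the meeting point, where [e] reconciles the two runs. *)
have qE k : q (size u + k) = r' (size u' + k).
  rewrite /q; case: k => [|k]; first by rewrite !addn0 leqnn.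
  by rewrite leqNgt -[X in X < _]addn0 ltn_add2l /= addKn addnC.
apply: (@accepting_run_accepts A D _ q); split=> [i|//|x0 i|].
- rewrite size_cat; case: (leqP i (size u)) => [le_iu _|/ltnW/subnKC <-].
    rewrite {2}/q le_iu; apply: hr.
    by rewrite size_cat (leq_trans le_iu) // leq_addr.
  rewrite leq_add2l qE => le_iv.
  (* Rigid symbols are carried from [r 0] to the shared state, back to [r' 0], then forward along
     [r']. *)
  apply: (same_rigid_trans (J := r' (size u'))).
    by rewrite -e; apply: hr; rewrite size_cat leq_addr.
  apply: (same_rigid_trans (J := r' 0)).
    by apply/same_rigid_sym/hr'; rewrite size_cat leq_addr.
  by apply: hr'; rewrite size_cat leq_add2l.
- rewrite size_cat; case: (ltnP i (size u)) => [lt_iu _|/subnKC <-].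
    rewrite /q (ltnW lt_iu) lt_iu nth_cat lt_iu.
    have := hT x0 i; rewrite nth_cat lt_iu; apply.
    by rewrite size_cat ltn_addr.
  rewrite ltn_add2l => lt_iv.
  rewrite -addnS !qE nth_cat ltnNge leq_addr /= addKn.
  have := hT' x0 (size u' + (i - size u)).
  rewrite size_cat ltn_add2l => /(_ lt_iv).
  by rewrite nth_cat ltnNge leq_addr /= addKn addnS.
- by rewrite size_cat qE -size_cat.
Qed.

End Runs.

Definition point_domains : domains unit :=
  Domains (carrier := fun=> unit) (fun=> inhabits tt).

Lemma args_point_eq (ss : seq unit) (x y : args point_domains ss) : x = y.
Proof.
by apply: functional_extensionality_dep => i; case: (x i); case: (y i).
Qed.

Lemma interp_point_pigeonhole (G : signature unit)
    (q : nat -> interp G point_domains) :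
  finite_set [set: psym G] -> exists m n, m != n /\ q m = q n.
Proof.
(* [psym G] is a bare type; its copy [{classic psym G}] has decidable equality, so the symbols can
   be listed in [s]. *)
move=> /(@finite_seqP {classic psym G})[s sE].
(* Argument tuples over the point are all equal, so one bit per predicate symbol records its whole
   interpretation. *)
pose code (I : interp G point_domains) : (size s).-tuple bool :=
  map_tuple (fun p : {classic psym G} => `[< exists x, pint I p x >])
    (in_tuple s).
have code_inj : injective code.
  move=> [fI pI] [fJ pJ] /(congr1 val)/= /(@eq_in_map {classic psym G}) eIJ.
  have -> : fI = fJ.
    by apply: functional_extensionality_dep => f; apply/funext => x;
      case: (fI f x); case: (fJ f x).
  suff -> : pI = pJ by [].
  apply: functional_extensionality_dep => p; apply/funext => x.
  have /eIJ : (p : {classic psym G}) \in s.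
    by have : [set` s] (p : {classic psym G}) by rewrite -sE.
  move=> eb; apply/propext; split=> hx.
    have /asboolP[y] : `[< exists x, pJ p x >].
      by rewrite -eb; apply/asboolP; exists x.
    by rewrite (args_point_eq x y).
  have /asboolP[y] : `[< exists x, pI p x >].
    by rewrite eb; apply/asboolP; exists x.
  by rewrite (args_point_eq x y).
apply: contrapT => no_coll.
pose N := #|{: (size s).-tuple bool}|.
have q_inj : injective (fun i : 'I_N.+1 => code (q i)).
  move=> i j /code_inj eq_q; apply/eqP; apply: contrapT => /negP ne_ij.
  by apply: no_coll; exists (val i), (val j).
by have := leq_card _ q_inj; rewrite card_ord ltnn.
Qed.

Definition bit_sig : signature unit :=
  {| Defs.fsym := void; fdom := fun=> [::]; fcod := fun=> tt;
     frigid := fun=> false;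
     psym := unit; pdom := fun=> [::]; prigid := fun=> false |}.

Definition point_theory : theory bit_sig :=
  [set FAll (s := tt) (FAll (s := tt)
         (FEq (Var bit_sig (VZ [:: tt] tt))
              (Var bit_sig (VS tt (VZ [::] tt)))))].

Definition bit (b : bool) : interp bit_sig point_domains :=
  @Interp unit bit_sig point_domains (fun f => match f with end) (fun _ _ => b).

(** Defined over arbitrary domains, so that membership of a word in [block_lang] does not depend on
    which one-element domain carries it. *)
Definition bit_of (sigma : structure bit_sig) : bool :=
  `[< exists x, pint (sint sigma) tt x >].

Lemma bitK : cancel (fun b => Structure point_domains (bit b)) bit_of.
Proof.
case; rewrite /bit_of; first by apply/asboolT; exists (fun=> tt).
by apply/asboolF => -[].
Qed.

Lemma words_bit (s : seq bool) :
  words point_theory (map (Structure point_domains) (map bit s)).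
Proof.
exists point_domains, (size s), (map_tuple bit (in_tuple s)).
split=> // i; split=> [?|phi ->]; first exact: (@countableP unit).
by move=> [] [].
Qed.

Definition block_word (m n : nat) : seq bool := nseq m true ++ nseq n false.

Definition block_lang : set (seq (structure bit_sig)) :=
  [set w | words point_theory w /\ exists n, map bit_of w = block_word n n].

Lemma map_bit_of (s : seq bool) :
  map bit_of (map (Structure point_domains) (map bit s)) = s.
Proof. by rewrite -2!map_comp (eq_map (g := id)) ?map_id //; exact: bitK. Qed.

Lemma block_word_inj (m n k : nat) : block_word m n = block_word k k -> m = n.
Proof.
move=> e; have := congr1 (count_mem true) e; have := congr1 (count_mem false) e.
by rewrite !count_cat !count_nseq !mul1n !mul0n !add0n !addn0 => -> ->.
Qed.

Lemma block_lang_not_regular : ~ regular point_theory block_lang.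
Proof.
case=> A LA.
(* Blocks of length [n.+1] keep the word nonempty, as [accepts_accepting_run] requires. *)
have acc n : exists r, accepting_run (A := A)
    (map bit (nseq n.+1 true) ++ map bit (nseq n.+1 false)) r.
  apply: accepts_accepting_run => //; rewrite -map_cat.
  suff : block_lang (map (Structure point_domains)
                         (map bit (block_word n.+1 n.+1))).
    by rewrite LA => -[].
  by split; [exact: words_bit | exists n.+1; rewrite map_bit_of].
have [r rP] := choice acc.
have [_ _ finP] := state_sig_finite A.
(* The states compared are those reached at the end of the block of ones. *)
have [m [n [ne_mn eq_q]]] := interp_point_pigeonhole (fun n => r n n.+1) finP.
(* The first block of the run for [m] is followed by the second block of the run for [n], an
   unbalanced word. *)
have : block_lang (map (Structure point_domains)
                       (map bit (block_word m.+1 n.+1))).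
  rewrite LA; split; first exact: words_bit.
  rewrite map_cat; apply: accepting_run_cat (rP m) (rP n) _.
  by rewrite !size_map !size_nseq.
case=> _ [k]; rewrite map_bit_of => /block_word_inj[e].
by rewrite e eqxx in ne_mn.
Qed.

Theorem theorem1 :
  exists (S : Type) (Sg : signature S),
    finite_signature Sg /\
    exists (T : theory Sg) (L : set (seq (structure Sg))),
      is_language T L /\ ~ regular T L.
Proof.
(* Finiteness of the signature keeps the claim from being vacuous: an infinite one admits no
   automaton at all. *)
exists unit, bit_sig; split; first by split; exact: finite_finset.
exists point_theory, block_lang; split; first by move=> w [].
exact: block_lang_not_regular.
Qed.
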